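(* Let $\mathcal{H}$ be a real Hilbert space and let $\mathcal{M}:\mathcal{H}\to\mathcal{H}$ be a linear, bounded, self-adjoint and positive semidefinite operator. Let $T:\mathcal{H}\to\mathcal{H}$ be $\mathcal{M}$-nonexpansive and $\mathcal{M}$-to-norm $L$-Lipschitz continuous with $\operatorname{Fix}(T)\neq\emptyset$. Then for any sequence $\{x^k\}$ generated by the PHA iteration for $T$, with anchoring parameters $\varphi_k$, and for an arbitrary fixed point $x^*$ of $T$: (i) $\displaystyle \|x^k-Tx^k\|_{\mathcal{M}}\le\frac{2}{\varphi_k+1}\|x^0-x^*\|_{\mathcal{M}}$ for all $k\ge1$; (ii) $\displaystyle \|x^k-Tx^k\|\le\frac{M(L+1)}{\varphi_k+1}+\frac{2L}{\varphi_{k-1}+1}\|x^0-x^*\|_{\mathcal{M}}$ for all $k\ge2$, where $M=\sup_{k\ge1}\max\{\|x^0-x^k\|_{\mathcal{M}},\ \|x^0-Tx^k\|\}$.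
   Context: Notation: $\langle x,y\rangle_{\mathcal{M}}=\langle \mathcal{M}x,y\rangle$ and $\|x\|_{\mathcal{M}}=\sqrt{\langle x,x\rangle_{\mathcal{M}}}$ (a seminorm). $\operatorname{Fix}(T)=\{x\in\mathcal{H}:Tx=x\}$. $T$ is $\mathcal{M}$-nonexpansive if $\|Tx-Ty\|_{\mathcal{M}}\le\|x-y\|_{\mathcal{M}}$ for all $x,y\in\mathcal{H}$. $T$ is $\mathcal{M}$-to-norm $L$-Lipschitz continuous if $\|Tx-Ty\|\le L\|x-y\|_{\mathcal{M}}$ for all $x,y\in\mathcal{H}$. PHA iteration (preconditioned Halpern iteration with adaptive anchoring parameters): given $x^0\in\mathcal{H}$, for $k=1,2,\dots$ set $$x^k=\frac{1}{\varphi_k+1}x^0+\frac{\varphi_k}{\varphi_k+1}Tx^{k-1},\qquad \varphi_k=\frac{2\langle x^{k-1}-Tx^{k-1},\,x^0-x^{k-1}\rangle_{\mathcal{M}}}{\|x^{k-1}-Tx^{k-1}\|_{\mathcal{M}}^2}+1.$$ It is assumed that $\|x^{k-1}-Tx^{k-1}\|_{\mathcal{M}}\neq 0$ for every $k\ge1$, so that all $\varphi_k$ are defined and the iteration produces an infinite sequence. *)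

(* Defs.v *)
From HB Require Import structures.
From mathcomp Require Import all_boot all_order all_algebra.
From mathcomp Require Import all_classical all_reals all_analysis.

Set Implicit Arguments.
Unset Strict Implicit.
Unset Printing Implicit Defensive.

Import Order.TTheory GRing.Theory Num.Theory.
Import numFieldNormedType.Exports.

Local Open Scope classical_set_scope.
Local Open Scope ring_scope.

Section Preconditioned.
Context {R : realType} {H : completeNormedModType R}.

(* A real Hilbert space is a complete normed space [H] together with an inner
   product [dot] satisfying [hilbert_norm dot]. *)
Definition hilbert_norm (dot : {dot H for idfun}) :=
  forall u : H, `|u| = Num.sqrt (dot u u).

Variables (dot : {dot H for idfun}) (M : H -> H).

Definition self_adjoint := forall u v : H, dot (M u) v = dot u (M v).

Definition positive_semidefinite := forall u : H, 0 <= dot (M u) u.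

Definition innerM (u v : H) : R := dot (M u) v.

Definition normM (u : H) : R := Num.sqrt (innerM u u).

Definition Fix (T : H -> H) : set H := [set u | T u = u].

Definition M_nonexpansive (T : H -> H) :=
  forall u v : H, normM (T u - T v) <= normM (u - v).

Definition M_to_norm_lipschitz (L : R) (T : H -> H) :=
  forall u v : H, `|T u - T v| <= L * normM (u - v).

(* [x] is the sequence of iterates (with initial point [x 0]) and [phi] the
   sequence of anchoring parameters; [phi 0] is not used and is arbitrary. *)
Definition PHA_iteration (T : H -> H) (x : nat -> H) (phi : nat -> R) :=
  forall k : nat, (1 <= k)%N ->
  [/\ normM (x k.-1 - T (x k.-1)) != 0,
      phi k = 2 * innerM (x k.-1 - T (x k.-1)) (x 0%N - x k.-1)
                / normM (x k.-1 - T (x k.-1)) ^+ 2 + 1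
    & x k = (1 / (phi k + 1)) *: x 0%N
            + (phi k / (phi k + 1)) *: T (x k.-1)].

Definition sup_set (T : H -> H) (x : nat -> H) : set R :=
  [set Num.max (normM (x 0%N - x k)) `|x 0%N - T (x k)|
     | k in [set k : nat | (1 <= k)%N]].

End Preconditioned.

(* Main.v *)
Require Import Defs.
From HB Require Import structures.
From mathcomp Require Import all_boot all_order all_algebra.
From mathcomp Require Import all_classical all_reals all_analysis.
From mathcomp Require Import ring lra.

Import Order.TTheory GRing.Theory Num.Theory.
Import numFieldNormedType.Exports.

Local Open Scope classical_set_scope.
Local Open Scope ring_scope.

(** The anchoring parameter [phi k] is the one for which the step from
    [y = x (k - 1)] to [x k] satisfies

      [phi k * normM (x k - y) = normM (x 0 - x k)],

    while [T y] is the point [x k + (x k - x 0) / phi k].  Expanding the square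
    of [normM (T (x k) - T y) <= normM (x k - y)] therefore cancels the terms
    in [normM (x 0 - x k)], and what is left, with [u = x k - T (x k)], is

      [phi k * normM u ^+ 2 <= 2 * innerM u (x 0 - x k)]

    ([PHA_residual_le]).  Read through the definition of [phi k.+1], this says
    [phi k + 1 <= phi k.+1], so that [k <= phi k]; the weights of every step
    are then convex.

    For (i), a fixed point [z] gives [normM u ^+ 2 <= 2 * innerM u (x k - z)]
    by nonexpansiveness ([residual_le_fix]).  The two inequalities add up to
    [(phi k + 1) * normM u ^+ 2 <= 2 * innerM u (x 0 - z)], and Cauchy-Schwarz
    for the semi-inner product finishes.

    For (ii), convexity and induction keep the iterates in the ball of radius
    [normM (x 0 - z)] around [z], whence the supremum is finite.  Subtracting
    [T (x k)] from the convex combination defining [x k] leaves the anchor term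
    [x 0 - T (x k)] and the term [T y - T (x k)]; the latter is at most
    [L * normM (x k - y)], and [x k - y] is again a combination of [x 0 - y] and
    [T y - y], whose second term is bounded by (i) at [k - 1]. *)

(** * The seminorm of a positive semidefinite operator *)

Lemma convex_combB (R : pzRingType) (V : lmodType R) (a c : R) (u v w : V) :
  a + c = 1 -> (a *: u + c *: v) - w = a *: (u - w) + c *: (v - w).
Proof.
by move=> ac1; rewrite !scalerBr addrACA -opprD -scalerDl ac1 scale1r.
Qed.

Section SemiInnerProduct.
Context {R : realType} {H : completeNormedModType R}.
Context (dot : {dot H for idfun}) (M : {linear H -> H}).
Hypothesis M_sa : self_adjoint dot M.
Hypothesis M_psd : positive_semidefinite dot M.

Local Notation "''[' u , v ]" := (innerM dot M u v).
Local Notation N := (normM dot M).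

Lemma innerMDl u v w : '[u + v, w] = '[u, w] + '[v, w].
Proof. by rewrite /innerM linearD linearDl. Qed.

Lemma innerMNl u w : '[- u, w] = - '[u, w].
Proof. by rewrite /innerM linearN linearNl. Qed.

Lemma innerMZl a u w : '[a *: u, w] = a * '[u, w].
Proof. by rewrite /innerM linearZ/= linearZl_LR. Qed.

Lemma innerMC u v : '[u, v] = '[v, u].
Proof. by rewrite /innerM M_sa (hermC dot) expr0 mul1r. Qed.

Lemma innerMDr u v w : '[w, u + v] = '[w, u] + '[w, v].
Proof. by rewrite innerMC innerMDl !(innerMC w). Qed.

Lemma innerMNr u w : '[w, - u] = - '[w, u].
Proof. by rewrite innerMC innerMNl (innerMC w). Qed.

Lemma innerMZr a u w : '[w, a *: u] = a * '[w, u].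
Proof. by rewrite innerMC innerMZl (innerMC w). Qed.

Definition innerME :=
  (innerMDl, innerMDr, innerMNl, innerMNr, innerMZl, innerMZr).

Lemma normM_ge0 u : 0 <= N u.
Proof. exact: sqrtr_ge0. Qed.

Lemma normM_sqr u : N u ^+ 2 = '[u, u].
Proof. by rewrite /normM sqr_sqrtr // /innerM M_psd. Qed.

Lemma normMZ a u : N (a *: u) = `|a| * N u.
Proof.
by rewrite /normM !innerME mulrA -expr2 sqrtrM ?sqr_ge0// sqrtr_sqr.
Qed.

Lemma normMN u : N (- u) = N u.
Proof. by rewrite -scaleN1r normMZ normrN1 mul1r. Qed.

Lemma innerM_quad_ge0 s t u v :
  0 <= s ^+ 2 * '[u, u] + 2 * s * t * '[u, v] + t ^+ 2 * '[v, v].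
Proof.
suff -> : s ^+ 2 * '[u, u] + 2 * s * t * '[u, v] + t ^+ 2 * '[v, v] =
          '[s *: u + t *: v, s *: u + t *: v] by exact: M_psd.
by rewrite !innerME (innerMC v u); ring.
Qed.

(** The form may be degenerate, so [N u] and [N v] need not be invertible.  If
    the product [N u * N v] is positive, positivity of the form at
    [N v *: u - N u *: v] is the claim up to the factor [2 * N u * N v];
    otherwise the form is affine along a suitable line through [u] or [v], and
    cannot stay nonnegative there with a nonzero slope [innerM u v]. *)
Lemma innerM_le u v : '[u, v] <= N u * N v.
Proof.
have degenerate a b : '[a, a] = 0 -> '[a, b] <= 0.
  move=> a0; rewrite leNgt; apply/negP => ab_gt0.
  (* This value of the parameter makes the quadratic equal to -1. *)
  pose t := (- ('[b, b] + 1)) / (2 * '[a, b]).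
  have := innerM_quad_ge0 t 1 a b.
  have -> : t ^+ 2 * '[a, a] + 2 * t * 1 * '[a, b] + 1 ^+ 2 * '[b, b] = -1.
    by rewrite a0 /t; field; lra.
  by lra.
have Nu := normM_sqr u; have Nv := normM_sqr v.
have [u0|u_gt0] := eqVneq (N u) 0.
  by rewrite u0 mul0r degenerate// -Nu u0 expr0n.
have [v0|v_gt0] := eqVneq (N v) 0.
  by rewrite v0 mulr0 innerMC degenerate// -Nv v0 expr0n.
have uv_gt0 : 0 < N u * N v by rewrite mulr_gt0// lt0r normM_ge0 ?u_gt0 ?v_gt0.
have := innerM_quad_ge0 (N v) (- N u) u v; rewrite -Nu -Nv.
have -> : N v ^+ 2 * N u ^+ 2 + 2 * N v * - N u * '[u, v]
            + (- N u) ^+ 2 * N v ^+ 2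
          = 2 * (N u * N v * (N u * N v - '[u, v])) by ring.
by rewrite pmulr_rge0 ?ltr0n// pmulr_rge0// subr_ge0.
Qed.

Lemma normMD u v : N (u + v) <= N u + N v.
Proof.
rewrite -ler_sqr ?nnegrE ?addr_ge0 ?normM_ge0// normM_sqr sqrrD !normM_sqr.
have -> : '[u + v, u + v] = '[u, u] + '[u, v] *+ 2 + '[v, v].
  by rewrite !innerME (innerMC v u); ring.
by have := innerM_le u v; rewrite !mulr2n; lra.
Qed.

Lemma normM_comb a c u v :
  0 <= a -> 0 <= c -> N (a *: u + c *: v) <= a * N u + c * N v.
Proof.
by move=> a0 c0; apply: (le_trans (normMD _ _)); rewrite !normMZ !ger0_norm.
Qed.

(** * One anchored step *)

(** The Gram expansion behind the choice of the anchoring parameter: here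
    [y1] and [w] are the images of [y] and of the new point [x1], and the
    hypothesis on [p] is the defining equation of [phi]. *)
Lemma anchored_step (p : R) (x0 y y1 w : H) :
  p + 1 != 0 ->
  (p - 1) * '[y - y1, y - y1] = 2 * '[y - y1, x0 - y] ->
  let x1 := (1 / (p + 1)) *: x0 + (p / (p + 1)) *: y1 in
  p ^+ 2 * ('[w - y1, w - y1] - '[x1 - y, x1 - y]) =
  p * (p * '[x1 - w, x1 - w] - 2 * '[x1 - w, x0 - x1]).
Proof.
move=> p1 hp x1; apply/eqP; rewrite -subr_eq0; apply/eqP.
(* The two sides differ by a multiple of the defining equation of [p]. *)
transitivity (- (p ^+ 2 / (p + 1)) *
    ((p - 1) * '[y - y1, y - y1] - 2 * '[y - y1, x0 - y])); last first.
  by rewrite hp subrr mulr0.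
rewrite /x1 !innerME (innerMC y x0) (innerMC y1 x0) (innerMC w x0).
rewrite (innerMC y1 y) (innerMC w y1).
by field.
Qed.

Section Iteration.
Variable T : H -> H.
Hypothesis T_nonexp : M_nonexpansive dot M T.

Lemma M_nonexpansive_inner u v :
  '[T u - T v, T u - T v] <= '[u - v, u - v].
Proof. by rewrite -!normM_sqr ler_sqr ?nnegrE ?normM_ge0. Qed.

(** This is [normM (T u - z) ^+ 2 <= normM (u - z) ^+ 2] expanded at
    [T u - z = (u - z) - (u - T u)]. *)
Lemma residual_le_fix z u :
  Fix T z -> '[u - T u, u - T u] <= 2 * '[u - T u, u - z].
Proof.
move=> Tz; have := M_nonexpansive_inner u z; rewrite Tz !innerME.
by rewrite (innerMC z u) (innerMC (T u) u) (innerMC z (T u)); lra.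
Qed.

(** * Growth of the anchoring parameters *)

Variables (x : nat -> H) (phi : nat -> R).
Hypothesis x_pha : PHA_iteration dot M T x phi.

Let r k := x k - T (x k).

Lemma residual_neq0 k : N (r k) != 0.
Proof. by case: (x_pha k.+1). Qed.

Lemma residual_inner_gt0 k : 0 < '[r k, r k].
Proof. by rewrite -normM_sqr exprn_gt0// lt0r residual_neq0 normM_ge0. Qed.

Lemma PHA_phiE k : (phi k.+1 - 1) * '[r k, r k] = 2 * '[r k, x 0%N - x k].
Proof.
have [//|_ -> _] := x_pha k.+1; rewrite normM_sqr /= addrK mulfVK//.
by rewrite gt_eqF ?residual_inner_gt0.
Qed.

Lemma PHA_stepE k :
  x k.+1 = (1 / (phi k.+1 + 1)) *: x 0%N
           + (phi k.+1 / (phi k.+1 + 1)) *: T (x k).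
Proof. by case: (x_pha k.+1). Qed.

Lemma PHA_residual_step k : 0 < phi k.+1 ->
  phi k.+1 * '[r k.+1, r k.+1] <= 2 * '[r k.+1, x 0%N - x k.+1].
Proof.
move=> phi_gt0.
have phi1 : phi k.+1 + 1 != 0 by lra.
have := anchored_step _ _ _ _ (T (x k.+1)) phi1 (PHA_phiE k).
rewrite /= -PHA_stepE => stepE.
have := M_nonexpansive_inner (x k.+1) (x k); rewrite -subr_le0 => nonexp.
rewrite -subr_le0 -(pmulr_rle0 _ phi_gt0) -stepE.
by rewrite mulr_ge0_le0 ?sqr_ge0.
Qed.

(** By the definition of [phi k.+2], the residual inequality at [k.+1] is the
    growth [phi k.+1 + 1 <= phi k.+2], and it needs [phi k.+1] positive; the
    induction starts at [phi 1 = 1]. *)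
Lemma phi_ge k : k.+1%:R <= phi k.+1.
Proof.
elim: k => [|k IH].
  have := PHA_phiE 0; rewrite subrr /innerM linear0r mulr0 => /eqP.
  by rewrite mulf_eq0 (gt_eqF (residual_inner_gt0 0)) orbF subr_eq0 => /eqP ->.
have phi_gt0 : 0 < phi k.+1 by apply: lt_le_trans IH.
have := PHA_residual_step k phi_gt0; rewrite -PHA_phiE.
by rewrite ler_pM2r ?residual_inner_gt0// -(natr1 k.+1); lra.
Qed.

Lemma phi_gt0 k : 0 < phi k.+1.
Proof. exact: lt_le_trans (phi_ge k). Qed.

Lemma PHA_residual_le k :
  phi k.+1 * '[r k.+1, r k.+1] <= 2 * '[r k.+1, x 0%N - x k.+1].
Proof. exact/PHA_residual_step/phi_gt0. Qed.

Lemma PHA_weights k :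
  [/\ 0 <= 1 / (phi k.+1 + 1), 0 <= phi k.+1 / (phi k.+1 + 1),
      phi k.+1 / (phi k.+1 + 1) <= 1
    & 1 / (phi k.+1 + 1) + phi k.+1 / (phi k.+1 + 1) = 1].
Proof.
have phi0 := phi_gt0 k; have phi1 : 0 < phi k.+1 + 1 by lra.
split; [by apply: divr_ge0; lra..| | by field; lra].
by rewrite ler_pdivrMr//; lra.
Qed.

(** * Decay of the residual *)

Lemma PHA_residual_rate z k : Fix T z ->
  N (r k.+1) <= 2 / (phi k.+1 + 1) * N (x 0%N - z).
Proof.
move=> Tz; have phi0 := phi_gt0 k; have phi1 : 0 < phi k.+1 + 1 by lra.
have rN : 0 < N (r k.+1) by rewrite lt0r residual_neq0 normM_ge0.
rewrite mulrAC ler_pdivlMr// -(ler_pM2l rN).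
have -> : N (r k.+1) * (N (r k.+1) * (phi k.+1 + 1)) =
          (phi k.+1 + 1) * N (r k.+1) ^+ 2 by ring.
rewrite normM_sqr.
have := PHA_residual_le k; have := residual_le_fix z (x k.+1) Tz.
have := innerM_le (r k.+1) (x 0%N - z).
have -> : '[r k.+1, x 0%N - z] =
          '[r k.+1, x 0%N - x k.+1] + '[r k.+1, x k.+1 - z].
  by rewrite -innerMDr addrA subrK.
by rewrite -/(r k.+1); lra.
Qed.

Lemma PHA_dist_fix z k : Fix T z -> N (x k - z) <= N (x 0%N - z).
Proof.
move=> Tz; elim: k => [//|k IH]; have [a0 c0 _ ac1] := PHA_weights k.
rewrite PHA_stepE convex_combB//; apply: (le_trans (normM_comb _ _ _ _ a0 c0)).
have TN : N (T (x k) - z) <= N (x 0%N - z).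
  by apply: le_trans IH; rewrite -{1}Tz.
by apply: (le_trans (lerD (lexx _) (ler_wpM2l c0 TN))); rewrite -mulrDl ac1 mul1r.
Qed.

Lemma PHA_step_dist k :
  N (x k.+1 - x k) <= 1 / (phi k.+1 + 1) * N (x 0%N - x k) + N (r k).
Proof.
have [a0 c0 c1 ac1] := PHA_weights k; rewrite [in x k.+1]PHA_stepE convex_combB//.
apply: (le_trans (normM_comb _ _ _ _ a0 c0)).
by rewrite lerD2l -normMN opprB ler_piMl ?normM_ge0.
Qed.

Variable L : R.
Hypothesis T_lip : M_to_norm_lipschitz dot M L T.

(** A negative [L] would force [normM] to vanish identically. *)
Lemma PHA_lipschitz_ge0 : 0 <= L.
Proof.
have := le_trans (normr_ge0 _) (T_lip (x 0%N) (T (x 0%N))).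
by rewrite pmulr_lge0// lt0r normM_ge0 andbT; exact: (residual_neq0 0).
Qed.

Lemma PHA_has_sup z : Fix T z -> has_sup (sup_set dot M T x).
Proof.
move=> Tz; have L0 := PHA_lipschitz_ge0; split; first by eexists; exists 1%N.
exists (Num.max (2 * N (x 0%N - z)) (`|x 0%N - z| + L * N (x 0%N - z))).
move=> _ [k _ <-]; have xk := PHA_dist_fix z k Tz.
rewrite ge_max !le_max; apply/andP; split; apply/orP; [left|right].
  rewrite -[_ - x k](subrKA z); apply: (le_trans (normMD _ _)).
  by rewrite -[X in _ + X]normMN opprB mulr_natl mulr2n lerD2l.
rewrite -[_ - T _](subrKA z); apply: (le_trans (ler_normD _ _)).
rewrite lerD2l distrC -{1}Tz; apply: (le_trans (T_lip _ _)).
exact: ler_wpM2l.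
Qed.

Lemma PHA_residual_norm_rate z k : Fix T z ->
  `|r k.+2| <= sup (sup_set dot M T x) * (L + 1) / (phi k.+2 + 1)
               + 2 * L / (phi k.+1 + 1) * N (x 0%N - z).
Proof.
move=> Tz; have L0 := PHA_lipschitz_ge0; set S := sup _.
have [_ bounded] := PHA_has_sup z Tz.
have leS j : N (x 0%N - x j.+1) <= S /\ `|x 0%N - T (x j.+1)| <= S.
  by apply/andP; rewrite -ge_max; apply: ub_le_sup => //; exists j.+1.
have [a0 c0 c1 ac1] := PHA_weights k.+1.
set a := 1 / _ in a0 ac1; set c := _ / _ in c0 c1 ac1.
have splitr : `|r k.+2| <=
    a * `|x 0%N - T (x k.+2)| + c * `|T (x k.+1) - T (x k.+2)|.
  rewrite /r {1}PHA_stepE -/a -/c convex_combB//; apply: (le_trans (ler_normD _ _)).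
  by rewrite (normrZ a) (normrZ c) (ger0_norm a0) (ger0_norm c0).
have lip : `|T (x k.+1) - T (x k.+2)| <=
    L * (a * S + 2 / (phi k.+1 + 1) * N (x 0%N - z)).
  rewrite distrC; apply: (le_trans (T_lip _ _)); apply: ler_wpM2l => //.
  apply: (le_trans (PHA_step_dist k.+1)); apply: lerD.
    exact: ler_wpM2l (leS k).1.
  exact: PHA_residual_rate.
have anchor := ler_wpM2l a0 (leS k.+1).2.
have lip' := le_trans (ler_piMl (normr_ge0 _) c1) lip.
apply: (le_trans splitr); apply: (le_trans (lerD anchor lip')).
by rewrite /a le_eqVlt; apply/orP; left; apply/eqP; ring.
Qed.

End Iteration.
End SemiInnerProduct.

Theorem theorem3p2 (R : realType) (H : completeNormedModType R)
    (dot : {dot H for idfun}) (dot_norm : hilbert_norm dot)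
    (M : {linear H -> H}) (M_bounded : bounded_fun_norm M)
    (M_sa : self_adjoint dot M) (M_psd : positive_semidefinite dot M)
    (T : H -> H) (L : R)
    (T_nonexp : M_nonexpansive dot M T)
    (T_lip : M_to_norm_lipschitz dot M L T)
    (T_fix : Fix T !=set0)
    (x : nat -> H) (phi : nat -> R) (x_pha : PHA_iteration dot M T x phi)
    (xstar : H) (xstar_fix : Fix T xstar) :
  (forall k : nat, (1 <= k)%N ->
     normM dot M (x k - T (x k)) <=
       2 / (phi k + 1) * normM dot M (x 0%N - xstar)) /\
  (has_sup (sup_set dot M T x) /\
   forall k : nat, (2 <= k)%N ->
     `|x k - T (x k)| <=
       sup (sup_set dot M T x) * (L + 1) / (phi k + 1)
       + 2 * L / (phi k.-1 + 1) * normM dot M (x 0%N - xstar)).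
Proof.
split; [|split].
- by case=> [//|k] _; apply: PHA_residual_rate.
- exact: (PHA_has_sup dot M M_sa M_psd T T_nonexp x phi x_pha L T_lip xstar).
- by case=> [|[|k]]// _; apply: PHA_residual_norm_rate.
Qed.
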